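(* Let $\alpha\in(0,1/2)$ and $r\in(0,1]$. For each integer $k>0$, the distance matrix $D_k(r)$ contains the patterns $A_0$, $A_1$, $B_0$, $B_1$, $C_0$ and $C_1$.
   Context: For $u=u_1\dots u_k\in\{0,1\}^k$ put $\kappa(u)=(1-\alpha)\sum_{i=1}^k u_i\alpha^{i-1}$, $\varrho(u,v)=|\kappa(u)-\kappa(v)|$, and $\gamma(u)=1+\sum_{i=1}^k u_i2^{k-i}\in\{1,\dots,2^k\}$ (so $\gamma$ is a bijection). The distance matrix $D_k(r)$ is the $2^k\times2^k$ zero-one matrix with $D_k(r)[\gamma(u),\gamma(v)]=1$ if $\varrho(u,v)\le r$ and $0$ otherwise. For an integer $i>1$ let $s_i$ be the integer with $2^{s_i}<i\le2^{s_i+1}$. All shifts $n,m$ and $h$ below are nonnegative integers. A zero-one matrix $M$ of size $2^k\times2^k$ contains - pattern $A_0$ if $M[i,j]=0$ implies: $M[i+n,j]=0$ for all $n\le2^k-i$ in case $i\ge j$, and $M[i,j+m]=0$ for all $m\le2^k-j$ in case $j\ge i$; - pattern $A_1$ if $M[i,j]=1$ implies $M[i-n,j]=M[i,j-m]=1$ for all $n\le i-j$, $m\le j-i$ (each condition being vacuous when its range is empty); - pattern $B_0$ if $M[1,j]=0$ implies $M[1+n,j+n]=0$ for all $n\le2^k-j$; - pattern $B_1$ if, for $j>1$, $M[1,j]=1$ implies $M[1+h2^{s_j+1},j+h2^{s_j+1}]=M[1+(h+1)2^{s_j+1}-j,(h+1)2^{s_j+1}]=1$ for all $0\le h<2^{k-s_j-1}$;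 - pattern $C_0$ if, for $j>1$ and $0\le m\le s_j$, $M[2^m,j]=0$ implies $M[2^m+h2^{s_j+1},j+h2^{s_j+1}]=M[1+(h+1)2^{s_j+1}-j,1+(h+1)2^{s_j+1}-2^m]=0$ for all $0\le h<2^{k-s_j-1}$; - pattern $C_1$ if, for $j>1$ and $0\le m\le s_j$, $M[2^m,j]=1$ implies $M[2^m+h2^{s_j+1}-n,j+h2^{s_j+1}-n]=1$ for all $0\le h<2^{k-s_j-1}$ and $0\le n<\min\{2^m,j-2^{s_j}\}$. *)

(* Defs.v *)
From mathcomp Require Import all_boot all_order all_algebra.
From mathcomp Require Import reals.

Set Implicit Arguments.
Unset Strict Implicit.
Unset Printing Implicit Defensive.
Import Order.TTheory GRing.Theory Num.Theory.

(* A word u = u_1 ... u_k is a tuple, so u_i is [tnth u] at the ordinal of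
   value i - 1; this accounts for the shifted exponents below. *)
Definition word (k : nat) := k.-tuple bool.

Section DistanceMatrix.
Variables (R : realType) (k : nat).
Implicit Types (u v : word k).

Definition kappa (alpha : R) u : R :=
  ((1 - alpha) * \sum_(i < k) (tnth u i)%:R * alpha ^+ i)%R.

Definition rho (alpha : R) u v : R := `|kappa alpha u - kappa alpha v|%R.

Definition gamma u : nat := 1 + \sum_(i < k) tnth u i * 2 ^ (k - i.+1).

(* Rows and columns are numbered 1, ..., 2^k, while p : 'I_(2 ^ k) starts at 0:
   p is the index of number p.+1. As gamma is a bijection onto {1, ..., 2^k},
   u and v below are unique; see [dist_mxE]. *)
Definition dist_mx (alpha r : R) : 'M[bool]_(2 ^ k) :=
  \matrix_(p, q) [exists u : word k, exists v : word k,
    [&& gamma u == p.+1, gamma v == q.+1 & (rho alpha u v <= r)%R]].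

End DistanceMatrix.

(* "M[i,j] = b" with 1-based i and j; it also asserts that both are in range,
   so no default value is ever read. *)
Definition entry (k : nat) (M : 'M[bool]_(2 ^ k)) (i j : nat) (b : bool) :
    Prop :=
  exists p q : 'I_(2 ^ k), [/\ i = p.+1, j = q.+1 & M p q = b].

(* The integer s_i of [slogP], for i > 1. *)
Definition slog (i : nat) : nat := trunc_log 2 i.-1.

Section Patterns.
Variables (k : nat) (M : 'M[bool]_(2 ^ k)).

Definition pattern_A0 : Prop :=
  forall i j, entry M i j false ->
    (j <= i -> forall n, n <= 2 ^ k - i -> entry M (i + n) j false) /\
    (i <= j -> forall m, m <= 2 ^ k - j -> entry M i (j + m) false).

(* The bounds n <= i - j and m <= j - i are on integers, so they are written
   without truncated subtraction. *)
Definition pattern_A1 : Prop :=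
  forall i j, entry M i j true ->
    (forall n, n + j <= i -> entry M (i - n) j true) /\
    (forall m, m + i <= j -> entry M i (j - m) true).

Definition pattern_B0 : Prop :=
  forall j, entry M 1 j false ->
    forall n, n <= 2 ^ k - j -> entry M (1 + n) (j + n) false.

Definition pattern_B1 : Prop :=
  forall j, 1 < j -> entry M 1 j true ->
    forall h, h < 2 ^ (k - slog j - 1) ->
      entry M (1 + h * 2 ^ (slog j + 1)) (j + h * 2 ^ (slog j + 1)) true /\
      entry M (1 + (h + 1) * 2 ^ (slog j + 1) - j)
              ((h + 1) * 2 ^ (slog j + 1)) true.

Definition pattern_C0 : Prop :=
  forall j m, 1 < j -> m <= slog j -> entry M (2 ^ m) j false ->
    forall h, h < 2 ^ (k - slog j - 1) ->
      entry M (2 ^ m + h * 2 ^ (slog j + 1)) (j + h * 2 ^ (slog j + 1)) false /\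
      entry M (1 + (h + 1) * 2 ^ (slog j + 1) - j)
              (1 + (h + 1) * 2 ^ (slog j + 1) - 2 ^ m) false.

Definition pattern_C1 : Prop :=
  forall j m, 1 < j -> m <= slog j -> entry M (2 ^ m) j true ->
    forall h n, h < 2 ^ (k - slog j - 1) -> n < minn (2 ^ m) (j - 2 ^ slog j) ->
      entry M (2 ^ m + h * 2 ^ (slog j + 1) - n)
              (j + h * 2 ^ (slog j + 1) - n) true.

End Patterns.

Lemma slogP (i : nat) : 1 < i -> 2 ^ slog i < i <= 2 ^ (slog i).+1.
Proof.
case: i => [|[|i]] // _; rewrite /slog /= ltnS.
by have /andP[-> /=] := trunc_log_bounds (isT : 1 < 2) (isT : 0 < i.+1).
Qed.

Lemma gamma_cons (k : nat) (b : bool) (u : word k) :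
  gamma [tuple of b :: u] = b * 2 ^ k + gamma u.
Proof.
rewrite /gamma big_ord_recl tnth0 subSS subn0 addnCA; congr (_ + (_ + _)).
by apply: eq_bigr => i _; rewrite tnthS.
Qed.

Lemma gamma_range (k : nat) (u : word k) : 0 < gamma u <= 2 ^ k.
Proof.
elim: k u => [|k IHk] u; first by rewrite /gamma big_ord0.
case/tupleP: u => b u; rewrite gamma_cons.
have /andP[u_gt0 u_le] := IHk u; rewrite addn_gt0 u_gt0 orbT /= expnS mul2n.
by rewrite -addnn leq_add // -[leqRHS]mul1n leq_mul2r leq_b1 orbT.
Qed.

Lemma gamma_inj (k : nat) : injective (@gamma k).
Proof.
elim: k => [|k IHk] u v; first by rewrite (tuple0 u) (tuple0 v).
case/tupleP: u => b u; case/tupleP: v => c v; rewrite !gamma_cons.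
have /andP[u_gt0 u_le] := gamma_range u.
have /andP[v_gt0 v_le] := gamma_range v.
case: b c => [] [] /=; rewrite ?mul1n ?mul0n ?add0n.
- by move=> /addnI/IHk->.
- by move=> E; move: v_le; rewrite -E -[leqRHS]addn0 leq_add2l leqNgt u_gt0.
- by move=> E; move: u_le; rewrite E -[leqRHS]addn0 leq_add2l leqNgt v_gt0.
- by move=> /IHk->.
Qed.

Lemma gamma_surj (k i : nat) : 0 < i <= 2 ^ k -> exists u : word k, gamma u = i.
Proof.
case: i => // i /= lt_i.
have lt_g (u : word k) : (gamma u).-1 < 2 ^ k.
  by have /andP[u_gt0 u_le] := gamma_range u; rewrite prednK.
have gE (u : word k) : (gamma u).-1.+1 = gamma u.
  by have /andP[u_gt0 _] := gamma_range u; rewrite prednK.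
pose g u := Ordinal (lt_g u).
have g_inj : injective g.
  move=> u v eq_g; apply: gamma_inj; rewrite -gE -[RHS]gE.
  by congr succn; apply: (congr1 val eq_g).
have [|g' _ gK] := inj_card_bij g_inj.
  by rewrite card_ord card_tuple card_bool.
exists (g' (Ordinal lt_i)); rewrite -gE; congr succn.
exact: (congr1 val (gK (Ordinal lt_i))).
Qed.

Lemma dist_mxE (R : realType) (k : nat) (alpha r : R) (u v : word k) :
  entry (dist_mx k alpha r) (gamma u) (gamma v) (rho alpha u v <= r)%R.
Proof.
have lt_g (w : word k) : (gamma w).-1 < 2 ^ k.
  by have /andP[w_gt0 w_le] := gamma_range w; rewrite prednK.
have gE (w : word k) : (gamma w).-1.+1 = gamma w.
  by have /andP[w_gt0 _] := gamma_range w; rewrite prednK.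
exists (Ordinal (lt_g u)), (Ordinal (lt_g v)); split; rewrite ?gE // mxE /= !gE.
apply/existsP/idP => [[u' /existsP[v']]|le_r].
  by case/and3P => /eqP/gamma_inj-> /eqP/gamma_inj->.
by exists u; apply/existsP; exists v; rewrite !eqxx.
Qed.

(* Main.v *)
Require Import Defs.
From mathcomp Require Import all_boot all_order all_algebra.
From mathcomp Require Import reals.
From mathcomp Require Import zify lra.

(** Numbering words from 0, kappa becomes the function [digit_sum] of the binary
    digits of the index. As alpha < 1/2, a carry in a binary addition can only
    increase it, so [digit_sum] is superadditive; and it is additive on
    carry-free sums, such as a multiple of 2^t plus a number below 2^t, or a
    number below 2^t plus its complement 2^t - 1 - n. All six patterns follow:
    shifting by a multiple of 2^t and complementing preserve distances, while
    superadditivity yields monotonicity, B0 and C1. *)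

Set Implicit Arguments.
Unset Strict Implicit.
Unset Printing Implicit Defensive.
Import Order.TTheory GRing.Theory Num.Theory.

(** * Weighted binary digits of an index *)

Section DigitSum.
Variables (R : realType) (alpha : R).
Local Open Scope ring_scope.

(** Digits are consumed from the least significant end, so that carries can be followed by halving.
    Digits at positions [k] and above are ignored. *)
Fixpoint digit_sum (k n : nat) : R :=
  if k is k'.+1 then
    digit_sum k' n./2 + (odd n)%:R * ((1 - alpha) * alpha ^+ k')
  else 0.

Lemma digit_sum0 k : digit_sum k 0 = 0.
Proof. by elim: k => //= k ->; rewrite mul0r addr0. Qed.

(** Bridges the two recursions: [kappa] and [gamma] peel off the leading letter of a word,
    [digit_sum] the last digit. *)
Lemma digit_sum_top k (b : bool) n : (n < 2 ^ k)%N ->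
  digit_sum k.+1 (b * 2 ^ k + n)%N = (1 - alpha) * b%:R + alpha * digit_sum k n.
Proof.
elim: k n => [|k IHk] n lt_n.
  have -> : n = 0%N by lia.
  by case: b => /=; rewrite expr0; lra.
have -> : digit_sum k.+2 (b * 2 ^ k.+1 + n)
    = digit_sum k.+1 (b * 2 ^ k + n./2)
      + (odd n)%:R * ((1 - alpha) * alpha ^+ k.+1).
  rewrite [LHS]/= -/(digit_sum k.+1 _); congr (digit_sum _ _ + (_ : bool)%:R * _).
    by rewrite expnS; lia.
  by rewrite oddD oddM oddX andbF.
rewrite IHk; last by move: lt_n; rewrite expnS; lia.
rewrite [digit_sum k.+1 n]/= exprS; lra.
Qed.

Lemma kappa_digit_sum k (u : word k) :
  kappa alpha u = digit_sum k (gamma u).-1.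
Proof.
elim: k u => [|k IHk] u; first by rewrite /kappa big_ord0 mulr0.
case/tupleP: u => b u; rewrite gamma_cons.
have /andP[u_gt0 u_le] := gamma_range u.
have -> : (b * 2 ^ k + gamma u).-1 = (b * 2 ^ k + (gamma u).-1)%N by lia.
rewrite digit_sum_top; last by lia.
rewrite -IHk /kappa big_ord_recl tnth0 expr0 mulr1.
under eq_bigr do rewrite tnthS lift0 exprS mulrCA.
by rewrite -mulr_sumr mulrDr mulrCA.
Qed.

(** The nonzero digits of the two summands occupy disjoint positions, below [t] and from [t]
    upward. *)
Lemma digit_sum_shift k t h c : (c < 2 ^ t)%N ->
  digit_sum k (h * 2 ^ t + c)%N = digit_sum k (h * 2 ^ t) + digit_sum k c.
Proof.
elim: t k c => [|t IHt] [|k] c lt_c; rewrite ?addr0 //.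
  have -> : c = 0%N by lia.
  by rewrite addn0 digit_sum0 addr0.
have E x : ((h * 2 ^ t.+1 + x)./2 = h * 2 ^ t + x./2)%N by rewrite expnS; lia.
have O x : odd (h * 2 ^ t.+1 + x) = odd x by rewrite oddD oddM oddX andbF.
have := E 0%N; have := O 0%N; rewrite !addn0 /= => O0 E0.
rewrite E O O0 E0 mul0r addr0 IHt ?addrA //.
by move: lt_c; rewrite expnS; lia.
Qed.

(** The sum consists of [t] ones, so at each position below [t] exactly one summand has digit 1, and
    nothing is carried. *)
Lemma digit_sum_compl k t a b : (a + b).+1 = (2 ^ t)%N ->
  digit_sum k (a + b)%N = digit_sum k a + digit_sum k b.
Proof.
elim: t k a b => [|t IHt] [|k] a b ab; rewrite ?addr0 //.
  have [-> ->] : a = 0%N /\ b = 0%N by lia.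
  by rewrite addn0 digit_sum0 addr0.
have ob : odd b = ~~ odd a by move: ab; rewrite expnS; lia.
have ab2 : ((a + b)./2 = a./2 + b./2)%N by lia.
rewrite /= ab2 oddD ob IHt; last by move: ab; rewrite expnS; lia.
by case: (odd a) => /=; lra.
Qed.

Hypothesis alpha_bnd : 0 < alpha < 1 / 2%:R.

Lemma digit_weight_ge0 k : 0 <= (1 - alpha) * alpha ^+ k.
Proof.
by have /andP[? ?] := alpha_bnd; rewrite mulr_ge0 ?exprn_ge0 //; lra.
Qed.

Lemma digit_sum_ge0 k n : 0 <= digit_sum k n.
Proof.
elim: k n => //= k IHk n.
by rewrite addr_ge0 ?IHk // mulr_ge0 ?ler0n ?digit_weight_ge0.
Qed.

(** A carry trades two digits of weight [alpha * w] for one of weight [w], and [2 * alpha * w <= w].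
    The bound on [a + b] keeps carries from leaving the top position. *)
Lemma digit_sum_superadd k a b : (a + b < 2 ^ k)%N ->
  digit_sum k a + digit_sum k b <= digit_sum k (a + b)%N.
Proof.
elim: k a b => [|k IHk] a b lt_ab; first by rewrite addr0.
have lt2 : ((a + b)./2 < 2 ^ k)%N by move: lt_ab; rewrite expnS; lia.
case odd_ab: (odd a && odd b); last first.
  have E : ((a + b)./2 = a./2 + b./2)%N by lia.
  have := IHk a./2 b./2; rewrite /= oddD -E => /(_ lt2) le_sum.
  by move: odd_ab; case: (odd a); case: (odd b) => //= _; lra.
have /andP[oa ob] := odd_ab.
(* The carry is a third summand, so the induction hypothesis is applied twice: first to split off
   [a./2], then to separate [b./2] from 1. *)
have E : ((a + b)./2 = a./2 + (b./2 + 1))%N by lia.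
rewrite /= oddD oa ob /=.
(* With a single digit, two odd summands would already reach 2. *)
case: k IHk lt_ab lt2 => [|k] IHk lt_ab lt2; first by lia.
have le1 := IHk a./2 (b./2 + 1)%N.
have le2 := IHk b./2 1%N.
have d1 : digit_sum k.+1 1 = (1 - alpha) * alpha ^+ k.
  by rewrite /= digit_sum0 add0r mul1r.
have {}le1 := le1 ltac:(lia); have {}le2 := le2 ltac:(lia).
rewrite -E in le1; rewrite d1 in le2; rewrite exprS.
have w_ge0 := digit_weight_ge0 k.
have carry : 0 <= (1 - 2%:R * alpha) * ((1 - alpha) * alpha ^+ k).
  by have /andP[_ ?] := alpha_bnd; rewrite mulr_ge0 //; lra.
move: le1 le2; rewrite -/(digit_sum k.+1 _); lra.
Qed.

Lemma digit_sum_mono k a b : (a <= b < 2 ^ k)%N ->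
  digit_sum k a <= digit_sum k b.
Proof.
case/andP => le_ab lt_b.
have := @digit_sum_superadd k a (b - a); rewrite subnKC // => /(_ lt_b).
by have := digit_sum_ge0 k (b - a); lra.
Qed.

End DigitSum.

(** * Matrix entries as differences of digit sums *)

Section Entries.
Variables (R : realType) (alpha r : R) (k : nat).
Hypothesis alpha_bnd : (0 < alpha < 1 / 2%:R)%R.
Local Notation M := (dist_mx k alpha r).
Local Notation d := (digit_sum alpha k).

Lemma entry_func i j b c : entry M i j b -> entry M i j c -> b = c.
Proof.
move=> [p [q [-> -> <-]]] [p' [q' [/succn_inj/val_inj<- /succn_inj/val_inj<- <-]]].
by [].
Qed.

Lemma entry_range i j b : entry M i j b -> 0 < i <= 2 ^ k /\ 0 < j <= 2 ^ k.
Proof. by case=> p [q [-> -> _]]; rewrite !ltn_ord. Qed.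

(** Monotonicity of the digit sum fixes the sign inside the absolute value of [rho]. *)
Lemma entry_digit_sum a b : a <= b < 2 ^ k ->
  entry M a.+1 b.+1 (d b - d a <= r)%R /\ entry M b.+1 a.+1 (d b - d a <= r)%R.
Proof.
move=> ab; have := ab => /andP[le_ab lt_b].
have [|u gu] := @gamma_surj k a.+1; first by lia.
have [|v gv] := @gamma_surj k b.+1; first by lia.
have d_ge0 : (0 <= d b - d a)%R by rewrite subr_ge0 digit_sum_mono.
have E : rho alpha v u = (d b - d a)%R.
  by rewrite /rho !kappa_digit_sum gu gv /= ger0_norm.
have E' : rho alpha u v = (d b - d a)%R by rewrite -E /rho distrC.
by have := dist_mxE alpha r u v; have := dist_mxE alpha r v u; rewrite gu gv E E'.
Qed.

Lemma entry_le a b c : a <= b -> entry M a.+1 b.+1 c ->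
  b < 2 ^ k /\ c = (d b - d a <= r)%R.
Proof.
move=> le_ab e; have [_ /= lt_b] := entry_range e; split=> //.
by apply: entry_func e (proj1 (entry_digit_sum _)); rewrite le_ab.
Qed.

Lemma entry_sym i j b : entry M i j b -> entry M j i b.
Proof.
move=> e; have [] := entry_range e; case: i j e => [|i] [|j] // e /= lt_i lt_j.
case/orP: (leq_total i j) => le_ij.
  have [|e1 e2] := @entry_digit_sum i j; first by rewrite le_ij.
  by rewrite (entry_func e e1).
have [|e1 e2] := @entry_digit_sum j i; first by rewrite le_ij.
by rewrite (entry_func e e2).
Qed.

Lemma entry_true i j a b : i = a.+1 -> j = b.+1 -> a <= b < 2 ^ k ->
  (d b - d a <= r)%R -> entry M i j true.
Proof. by move=> -> -> /entry_digit_sum[e _] <-. Qed.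

Lemma entry_false i j a b : i = a.+1 -> j = b.+1 -> a <= b < 2 ^ k ->
  (r < d b - d a)%R -> entry M i j false.
Proof. by move=> -> -> /entry_digit_sum[e _]; rewrite ltNge => /negbTE<-. Qed.

End Entries.

(** Here [b] is the column [j = b.+1] counted from 0, which turns the bounds on [j] into [b] having
    leading digit at position [slog j]. The second conclusion says that the [h]-th aligned block of
    length [2 ^ (slog j + 1)] fits into the matrix. *)
Lemma slog_bounds k b h : 0 < b < 2 ^ k -> h < 2 ^ (k - slog b.+1 - 1) ->
  2 ^ slog b.+1 <= b < 2 ^ (slog b.+1 + 1) /\
  (h + 1) * 2 ^ (slog b.+1 + 1) <= 2 ^ k.
Proof.
case/andP => b_gt0 lt_b lt_h; have := slogP (b_gt0 : 1 < b.+1).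
rewrite !ltnS addn1 => /andP[ge_b b_lt]; rewrite ge_b b_lt; split=> //.
have lt_s : slog b.+1 < k by rewrite -(ltn_exp2l _ _ (isT : 1 < 2)); lia.
rewrite -[in leqRHS](subnK lt_s) expnD leq_mul2r addn1.
by rewrite subnS -subn1 lt_h orbT.
Qed.

(** * The six patterns *)

Section PatternsOfDistanceMatrix.
Variables (R : realType) (alpha r : R) (k : nat).
Hypothesis alpha_bnd : (0 < alpha < 1 / 2%:R)%R.
Local Notation M := (dist_mx k alpha r).
Local Notation d := (digit_sum alpha k).

(** Moving away from the diagonal cannot decrease the distance. The row half is the transpose of the
    column half. *)
Lemma dist_mx_A0 : pattern_A0 M.
Proof.
have A0 i j m : i <= j -> m <= 2 ^ k - j -> entry M i j false ->
    entry M i (j + m) false.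
  move=> le_ij le_m e; have [] := entry_range e.
  case: i j le_ij le_m e => [|a] [|b] // le_ab le_m e _ _.
  have [//|lt_b /esym/negbT] := entry_le alpha_bnd _ e; rewrite -ltNge => lt_r.
  apply: (@entry_false _ _ _ _ alpha_bnd _ _ a (b + m)); [lia..|].
  have := @digit_sum_mono _ _ alpha_bnd k b (b + m) ltac:(lia); lra.
move=> i j e; split=> le_ij n le_n; last exact: A0.
by apply/(entry_sym alpha_bnd)/A0 => //; apply: entry_sym.
Qed.

Lemma dist_mx_A1 : pattern_A1 M.
Proof.
have A1 i j m : m + i <= j -> entry M i j true -> entry M i (j - m) true.
  move=> le_m e; have [] := entry_range e.
  case: i j le_m e => [|a] [|b] // le_m e _ _.
  have [|lt_b /esym le_r] := entry_le alpha_bnd _ e; first by lia.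
  apply: (@entry_true _ _ _ _ alpha_bnd _ _ a (b - m)); [lia..|].
  have := @digit_sum_mono _ _ alpha_bnd k (b - m) b ltac:(lia); lra.
move=> i j e; split=> n le_n; last exact: A1.
by apply/(entry_sym alpha_bnd)/A1 => //; apply: entry_sym.
Qed.

(** Row 1 is index 0, so the given entry compares [d b] with [r]; superadditivity yields
    [d (b + n) - d n >= d b]. *)
Lemma dist_mx_B0 : pattern_B0 M.
Proof.
move=> [|b] e n le_n; first by have [_] := entry_range e.
have [//|lt_b /esym/negbT] := entry_le alpha_bnd _ e.
rewrite -ltNge digit_sum0 subr0 => lt_r.
apply: (@entry_false _ _ _ _ alpha_bnd _ _ n (b + n)); [lia..|].
have := @digit_sum_superadd _ _ alpha_bnd k b n ltac:(lia); lra.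
Qed.

Lemma dist_mx_B1 : pattern_B1 M.
Proof.
move=> [|b] // b_gt0 e h lt_h.
have [//|lt_b /esym] := entry_le alpha_bnd _ e; rewrite digit_sum0 subr0 => le_r.
have [|/andP[ge_b b_lt] le_h] := @slog_bounds k b h _ lt_h; first by lia.
set s := (slog b.+1 + 1)%N in b_lt le_h *.
split.
  apply: (@entry_true _ _ _ _ alpha_bnd _ _ (h * 2 ^ s) (h * 2 ^ s + b)); [lia..|].
  rewrite digit_sum_shift //; lra.
(* The reflection [x -> 2 ^ s - 1 - x] inside the block sends the pair 0, [b] to these offsets, in
   reverse order. *)
apply: (@entry_true _ _ _ _ alpha_bnd _ _ (h * 2 ^ s + (2 ^ s - 1 - b))
  (h * 2 ^ s + (2 ^ s - 1))); [lia..|].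
rewrite !digit_sum_shift; [|lia..].
have := @digit_sum_compl _ alpha k s (2 ^ s - 1 - b) b ltac:(lia).
rewrite subnK; [lra|lia].
Qed.

Lemma dist_mx_C0 : pattern_C0 M.
Proof.
move=> [|b] m // b_gt0 le_m e h lt_h.
have [_ /= lt_b] := entry_range e.
have [|/andP[ge_b b_lt] le_h] := @slog_bounds k b h _ lt_h; first by lia.
set s := (slog b.+1 + 1)%N in b_lt le_h *.
have le_2m : 2 ^ m <= 2 ^ slog b.+1 by rewrite leq_exp2l.
(* Counted from 0 the row is [a = 2 ^ m - 1]; it lies left of [b] because [m <= slog b.+1]. *)
have [a Ea] : exists a, 2 ^ m = a.+1.
  by exists (2 ^ m).-1; rewrite prednK ?expn_gt0.
rewrite Ea in e le_2m *.
have [|_ /esym/negbT] := entry_le alpha_bnd _ e; first by lia.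
rewrite -ltNge => lt_r; split.
  apply: (@entry_false _ _ _ _ alpha_bnd _ _ (h * 2 ^ s + a) (h * 2 ^ s + b));
    [lia..|].
  rewrite !digit_sum_shift; [lra|lia..].
(* Reflecting the block swaps the roles of [a] and [b] and keeps their distance. *)
apply: (@entry_false _ _ _ _ alpha_bnd _ _ (h * 2 ^ s + (2 ^ s - 1 - b))
  (h * 2 ^ s + (2 ^ s - 1 - a))); [lia..|].
rewrite !digit_sum_shift; [|lia..].
have := @digit_sum_compl _ alpha k s (2 ^ s - 1 - b) b ltac:(lia).
have := @digit_sum_compl _ alpha k s (2 ^ s - 1 - a) a ltac:(lia).
rewrite !subnK; [lra|lia..].
Qed.

Lemma dist_mx_C1 : pattern_C1 M.
Proof.
move=> [|b] m // b_gt0 le_m e h n lt_h; rewrite leq_min => /andP[lt_n _].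
have [_ /= lt_b] := entry_range e.
have [|/andP[ge_b b_lt] le_h] := @slog_bounds k b h _ lt_h; first by lia.
set s := (slog b.+1 + 1)%N in b_lt le_h *.
have le_2m : 2 ^ m <= 2 ^ slog b.+1 by rewrite leq_exp2l.
have [a Ea] : exists a, 2 ^ m = a.+1.
  by exists (2 ^ m).-1; rewrite prednK ?expn_gt0.
(* All [m] digits of [a] are 1, so subtracting [n] lowers [d a] by exactly [d n], whereas [d b]
   drops by at least [d n]. Hence the distance does not grow. *)
have a_compl := @digit_sum_compl _ alpha k m (a - n) n ltac:(lia).
rewrite Ea in e le_2m lt_n *.
have [|_ /esym le_r] := entry_le alpha_bnd _ e; first by lia.
apply: (@entry_true _ _ _ _ alpha_bnd _ _ (h * 2 ^ s + (a - n))
  (h * 2 ^ s + (b - n))); [lia..|].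
rewrite !digit_sum_shift; [|lia..].
have := @digit_sum_superadd _ _ alpha_bnd k (b - n) n ltac:(lia).
move: a_compl; rewrite !subnK; [lra|lia..].
Qed.

End PatternsOfDistanceMatrix.

Theorem lemma16 (R : realType) (alpha r : R)
    (halpha : (0 < alpha < 1 / 2%:R)%R) (hr : (0 < r <= 1)%R)
    (k : nat) (hk : (0 < k)%N) :
  pattern_A0 (dist_mx k alpha r) /\
  pattern_A1 (dist_mx k alpha r) /\
  pattern_B0 (dist_mx k alpha r) /\
  pattern_B1 (dist_mx k alpha r) /\
  pattern_C0 (dist_mx k alpha r) /\
  pattern_C1 (dist_mx k alpha r).
Proof.
split; first exact: dist_mx_A0.
split; first exact: dist_mx_A1.
split; first exact: dist_mx_B0.
split; first exact: dist_mx_B1.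
split; [exact: dist_mx_C0 | exact: dist_mx_C1].
Qed.
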